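(* Let $R$ be an associative ring with unity $1$ and let $a,b,c,v,w\in R$ with at least one of $v$, $w$ invertible. Then the hybrid $(v,w)$-weighted $(b,c)$-inverse of $a$ exists if and only if $R=vawbR\oplus rann(c)$ and $rann(vaw)\cap bR=\{0\}$.
   Context: For $x\in R$: $xR=\{xr: r\in R\}$ and $rann(x)=\{z\in R: xz=0\}$. $R=A\oplus B$ means $R=A+B$ and $A\cap B=\{0\}$. An element $y\in R$ is the hybrid $(v,w)$-weighted $(b,c)$-inverse of $a$ if $yvawy=y$, $yvR=bR$ and $rann(c)=rann(wy)$. *)

(* Defs.v *)
From HB Require Import structures.
From mathcomp Require Import all_boot all_algebra.
From mathcomp Require Import boolp classical_sets.

Set Implicit Arguments.
Unset Strict Implicit.
Unset Printing Implicit Defensive.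

Import GRing.Theory.
Local Open Scope classical_set_scope.
Local Open Scope ring_scope.

(* [pzRingType] is an associative ring with unity, possibly the zero ring.  A
   [unitRingType] structure would assume that invertibility is decidable, so
   two-sided invertibility is spelled out. *)
Definition invertible (R : pzRingType) (x : R) : Prop :=
  exists x' : R, x * x' = 1 /\ x' * x = 1.

Definition rideal (R : pzRingType) (x : R) : set R := [set x * r | r in setT].

Definition rann (R : pzRingType) (x : R) : set R := [set z | x * z = 0].

Definition sumset (R : pzRingType) (A B : set R) : set R :=
  [set s + t | s in A & t in B].

Definition ring_direct_sum (R : pzRingType) (A B : set R) : Prop :=
  [set: R] = sumset A B /\ A `&` B = [set 0].

Definition is_hybrid_weighted_inverse (R : pzRingType) (v w b c a y : R) : Prop :=
  [/\ y * v * a * w * y = y,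
      rideal (y * v) = rideal b
    & rann c = rann (w * y)].

(* Main.v *)
(* Writing p = vaw: if y is the inverse, then x = p y x + (1 - p y) x is the
   decomposition of x along p b R and rann c.  Conversely, decompose
   1 = p b t + u with c u = 0; then y = b t is the inverse, because p b t is the
   projection onto p b R along rann c and p is injective on b R. *)
Require Import Defs.
From HB Require Import structures.
From mathcomp Require Import all_boot all_algebra.
From mathcomp Require Import boolp classical_sets.

Import GRing.Theory.
Local Open Scope classical_set_scope.
Local Open Scope ring_scope.

(** Both intersections vanish because left multiplication by [y * (v * a * w)] is the identity on
    [yR], which contains [bR = yvR]. *)
Lemma hybrid_inverse_decomposition (R : pzRingType) (v w b c a y : R) :
  is_hybrid_weighted_inverse v w b c a y ->
  ring_direct_sum (rideal (v * a * w * b)) (rann c) /\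
  rann (v * a * w) `&` rideal b = [set 0].
Proof.
move=> [yy yb yc].
have b_yv r : exists s, b * r = y * v * s.
  have : rideal (y * v) (b * r) by rewrite yb; exists r.
  by case=> s _ <-; exists s.
have yv_b r : exists s, y * v * r = b * s.
  have : rideal b (y * v * r) by rewrite -yb; exists r.
  by case=> s _ <-; exists s.
have cE z : c * z = 0 <-> w * y * z = 0.
  by rewrite -[c * z = 0]/(rann c z) yc.
have yK s : y * (v * a * w * (y * s)) = y * s by rewrite !mulrA yy.
split; first split.
- apply/seteqP; split=> // x _.
  (* Since [y x = y v (a w y x)] lies in [yvR = bR], this [s] satisfies [b s = y x]. *)
  have [s Es] := yv_b (a * w * y * x).
  exists (v * a * w * b * s); first by exists s.
  exists (x - v * a * w * b * s); last by rewrite addrC subrK.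
  apply/cE; rewrite -[_ * b * s]mulrA -Es mulrBr.
  have -> : y * v * (a * w * y * x) = y * x by rewrite !mulrA yy.
  by rewrite -[w * y * (_ * _)]mulrA yK mulrA subrr.
- apply/seteqP; split=> [z [[r _ <-]] /cE|_ ->]; last first.
    by split; [exists 0; rewrite ?mulr0 | rewrite /rann /= mulr0].
  (* By [yK], [w y z = 0] becomes [w b r = 0], and [z = v a (w b r)]. *)
  have [s Es] := b_yv r.
  rewrite -[_ * b * r]mulrA Es -[y * v * s]mulrA.
  rewrite -[w * y * _]mulrA yK => w0.
  by rewrite /= -[v * a * w * _]mulrA w0 mulr0.
- apply/seteqP; split=> [z [/= pz [r _ rz]]|_ ->]; last first.
    by split; [rewrite /rann /= mulr0 | exists 0; rewrite ?mulr0].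
  have [s Es] := b_yv r.
  have Ez : z = y * (v * s) by rewrite mulrA -Es rz.
  by rewrite Ez -yK -Ez pz mulr0.
Qed.

Lemma hybrid_inverse_of_decomposition (R : pzRingType) (v w b c a : R) :
  ring_direct_sum (rideal (v * a * w * b)) (rann c) ->
  rann (v * a * w) `&` rideal b = [set 0] ->
  exists y, is_hybrid_weighted_inverse v w b c a y.
Proof.
move=> [sumE capE] injE.
have [_ [t _ <-] [u cu tu1]] :
    sumset (rideal (v * a * w * b)) (rann c) 1 by rewrite -sumE.
have cap0 z : rideal (v * a * w * b) z -> rann c z -> z = 0.
  by move=> hz hc; have : [set 0] z by rewrite -capE.
have inj0 z : v * a * w * (b * z) = 0 -> b * z = 0.
  by move=> hz; suff : [set 0] (b * z) by []; rewrite -injE; split=> //; exists z.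
have projE z : z = v * a * w * b * t * z + u * z by rewrite -mulrDl tu1 mul1r.
have cuz z : c * (u * z) = 0 by rewrite mulrA cu mul0r.
(* By injectivity of [p = vaw] on [bR], it suffices that [p b (t p b - 1) = 0]. This element of
   [pbR] equals [- u p b], so it also lies in [rann c]. *)
have ypb : b * t * (v * a * w * b) = b.
  apply/eqP; rewrite -subr_eq0; apply/eqP.
  rewrite -[X in _ - X](mulr1 b) -mulrA -mulrBr; apply: inj0.
  rewrite mulrA; apply: cap0; first by exists (t * (v * a * w * b) - 1).
  have -> : v * a * w * b * (t * (v * a * w * b) - 1) =
            - (u * (v * a * w * b)).
    by rewrite mulrBr mulr1 mulrA [X in _ - X]projE opprD addrA subrr add0r.
  by rewrite /rann /= mulrN cuz oppr0.
exists (b * t); split.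
- by rewrite -{3}ypb !mulrA.
- apply/seteqP; split=> _ [r _ <-].
    by exists (t * v * r); rewrite // !mulrA.
  (* By [ypb], [b r = (b t) v (a w b r)]. *)
  by exists (a * w * b * r); rewrite // -[X in _ = X * _]ypb !mulrA.
- apply/seteqP; split=> z /= hz.
    (* When [c z = 0], [p b t z = z - u z] lies in both summands, hence is zero; injectivity then
       gives [b t z = 0]. *)
    have pz0 : v * a * w * b * (t * z) = 0.
      apply: cap0; first by exists (t * z).
      have -> : v * a * w * b * (t * z) = z - u * z.
        by rewrite {2}[z]projE addrK mulrA.
      by rewrite /rann /= mulrBr hz cuz subrr.
    rewrite -[_ * b * _]mulrA in pz0; rewrite /rann /= -!mulrA.
    by rewrite (inj0 _ pz0) mulr0.
  (* Conversely, [w b t z = 0] kills the [pbR] component of [z], leaving [u z], which [c]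
     annihilates. *)
  rewrite /rann /= [z]projE.
  have -> : v * a * w * b * t * z = v * a * (w * (b * t) * z) by rewrite !mulrA.
  by rewrite hz mulr0 add0r.
Qed.

Theorem theorem4p3 (R : pzRingType) (a b c v w : R)
    (hvw : invertible v \/ invertible w) :
  (exists y : R, is_hybrid_weighted_inverse v w b c a y) <->
  (ring_direct_sum (rideal (v * a * w * b)) (rann c) /\
   rann (v * a * w) `&` rideal b = [set 0]).
Proof.
split=> [[y]|[]]; first exact: hybrid_inverse_decomposition.
exact: hybrid_inverse_of_decomposition.
Qed.
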